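(* Let $x=(x_1,\dots,x_n)\in S(A,b)$. Then $x$ is a minimal solution of the system $\sum_{j\in J}T_L(a_{ij},x_j)\ge b_i$ $(i\in I)$ if and only if there exists an $i\in I$ such that $\sum_{j\in J}T_L(a_{ij},x_j)=b_i$ and $a_{ij}+x_j-1>0$ for every $j\in J^*(x)$.
   Context: Let $I=\{1,\dots,m\}$, $J=\{1,\dots,n\}$, $A=(a_{ij})_{m\times n}$ with $a_{ij}\in[0,1]$, and $b=(b_1,\dots,b_m)$ with $b_i>0$ real. The Łukasiewicz t-norm is $T_L(a,x)=\max\{a+x-1,0\}$ on $[0,1]^2$. The solution set is $S(A,b)=\{x\in[0,1]^n : \sum_{j\in J}T_L(a_{ij},x_j)\ge b_i \text{ for all } i\in I\}$. Vectors are ordered componentwise. A solution $\check x\in S(A,b)$ is minimal if $x\in S(A,b)$ and $x\le\check x$ imply $x=\check x$. For $x\in[0,1]^n$, $J^*(x)=\{j\in J : x_j>0\}$.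
   Formalization: The index i may depend on j: for every j∈J*(x) there is an i∈I with the i-th sum equal to b_i and a_ij+x_j−1>0. One i for all j is false: A the 2×2 identity, b=x=(1/2,1/2) is minimal, yet a_12+x_2−1<0 and a_21+x_1−1<0. *)

(* Defs.v *)
From mathcomp Require Import all_boot all_order all_algebra.
From mathcomp Require Import reals.

Set Implicit Arguments.
Unset Strict Implicit.
Unset Printing Implicit Defensive.

Import Order.TTheory GRing.Theory Num.Theory.
Local Open Scope ring_scope.

(* Total on R; it is the Lukasiewicz t-norm on [0, 1]^2. *)
Definition lukasiewicz (R : realType) (a x : R) : R := Num.max (a + x - 1) 0.

Section System.
Context {R : realType} {m n : nat}.
Implicit Types (A : 'M[R]_(m, n)) (b : 'rV[R]_m) (x y : 'rV[R]_n).

Definition lev x y : Prop := forall j, x 0 j <= y 0 j.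

Definition in_unit_cube x : Prop := forall j, 0 <= x 0 j <= 1.

Definition row_sum A x (i : 'I_m) : R := \sum_(j < n) lukasiewicz (A i j) (x 0 j).

Definition solution A b x : Prop :=
  in_unit_cube x /\ forall i, b 0 i <= row_sum A x i.

Definition minimal_solution A b x : Prop :=
  solution A b x /\ forall y, solution A b y -> lev y x -> y = x.

Definition pos_support x : {set 'I_n} := [set j | 0 < x 0 j].

End System.

(* Main.v *)
(** Lowering one coordinate [j] of a solution by [e] changes a row sum by at
    most [e], and does not change it when [A i j + x 0 j <= 1].  So a coordinate
    that no tight row sees with [A i j + x 0 j > 1] can be lowered by the
    smallest slack of the non-tight rows. *)
Require Import Defs.
From mathcomp Require Import all_boot all_order all_algebra.
From mathcomp Require Import reals.
From mathcomp Require Import lra.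
Import Order.TTheory GRing.Theory Num.Theory.
Local Open Scope ring_scope.

Lemma lukasiewicz_le (R : realType) (a x y : R) :
  x <= y -> lukasiewicz a x <= lukasiewicz a y.
Proof.
by move=> xy; rewrite /lukasiewicz; case: (lerP (a + x - 1) 0);
  case: (lerP (a + y - 1) 0); lra.
Qed.

(** Positivity at the larger argument suffices: [a + y - 1] exceeds both [a + x - 1] and 0. *)
Lemma lukasiewicz_lt (R : realType) (a x y : R) :
  x < y -> 0 < a + y - 1 -> lukasiewicz a x < lukasiewicz a y.
Proof.
by move=> xy; rewrite /lukasiewicz; case: (lerP (a + x - 1) 0);
  case: (lerP (a + y - 1) 0); lra.
Qed.

Lemma lukasiewicz_sub_ge (R : realType) (a x e : R) : 0 <= e ->
  lukasiewicz a x - e <= lukasiewicz a (x - e).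
Proof.
by move=> e0; rewrite /lukasiewicz; case: (lerP (a + x - 1) 0);
  case: (lerP (a + (x - e) - 1) 0); lra.
Qed.

Section RowSum.
Context {R : realType} {m n : nat}.
Implicit Types (A : 'M[R]_(m, n)) (b : 'rV[R]_m) (x y : 'rV[R]_n).

(** Term [j] drops strictly, and by monotonicity no other term grows. *)
Lemma row_sum_lt A x y i j : lev y x -> y 0 j < x 0 j ->
  0 < A i j + x 0 j - 1 -> row_sum A y i < row_sum A x i.
Proof.
move=> yx yxj Aj; rewrite /row_sum (bigD1 j) //= [ltRHS](bigD1 j) //=.
apply: ltr_leD; first exact: lukasiewicz_lt.
by apply: ler_sum => k _; apply: lukasiewicz_le.
Qed.

Definition lower_coord x (j : 'I_n) (e : R) : 'rV[R]_n :=
  \row_k (if k == j then x 0 k - e else x 0 k).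

Lemma row_sum_lower_coord A x i j e :
  row_sum A (lower_coord x j e) i =
  row_sum A x i - lukasiewicz (A i j) (x 0 j)
    + lukasiewicz (A i j) (x 0 j - e).
Proof.
rewrite /row_sum (bigD1 j) //= [in RHS](bigD1 j) //= mxE eqxx.
rewrite (eq_bigr (fun k => lukasiewicz (A i k) (x 0 k))); first lra.
by move=> k kj; rewrite mxE (negPf kj).
Qed.

Lemma lower_coord_solution A b x j e : solution A b x ->
  0 <= e -> e <= x 0 j ->
  (forall i, A i j + x 0 j - 1 <= 0 \/ e <= row_sum A x i - b 0 i) ->
  solution A b (lower_coord x j e).
Proof.
move=> [xI xb] e0 ej H; split=> [k|i].
  rewrite mxE; have /andP[x0 x1] := xI k.
  by case: eqP => [kj|_]; apply/andP; split=> //; move: x1 ej; rewrite ?kj; lra.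
rewrite row_sum_lower_coord; have := xb i; case: (H i) => [A0|slack].
  (* Term [j] is 0 both before and after lowering, so the row sum is unchanged. *)
  rewrite /lukasiewicz !max_r //; first by lra.
  by move: e0 A0; lra.
by have := lukasiewicz_sub_ge _ (A i j) (x 0 j) e e0; lra.
Qed.

End RowSum.

(** The tight row may depend on [j]: for the 2 by 2 identity matrix and [b] = (1/2, 1/2), the
    minimal solution (1/2, 1/2) needs a different row for each coordinate. *)
Theorem theorem3p1 (R : realType) (m n : nat)
    (A : 'M[R]_(m, n)) (b : 'rV[R]_m) (x : 'rV[R]_n)
    (hA : forall i j, 0 <= A i j <= 1)
    (hb : forall i, 0 < b 0 i)
    (hx : solution A b x) :
  minimal_solution A b x <->
  (forall j : 'I_n, j \in pos_support x ->
     exists i : 'I_m, row_sum A x i = b 0 i /\ 0 < A i j + x 0 j - 1).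
Proof.
split=> [[_ xmin] j|tight]; last first.
  split=> // y [yI yb] yx; apply/rowP => j; apply/eqP.
  rewrite eq_le yx /= leNgt; apply/negP => yxj.
  have [|i [xi Aj]] := tight j.
    (* [j] lies in the support because [x 0 j] exceeds [y 0 j], which is nonnegative. *)
    by rewrite inE; apply: le_lt_trans yxj; case/andP: (yI j).
  by have := row_sum_lt _ _ _ _ _ yx yxj Aj; rewrite xi ltNge yb.
rewrite inE => xj.
have [/existsP[i /andP[/eqP xi Aj]]|] :=
    boolP [exists i, (row_sum A x i == b 0 i) && (0 < A i j + x 0 j - 1)].
  by exists i.
rewrite negb_exists => /forallP noti; exfalso.
(* The default [x 0 j] keeps the lowered coordinate nonnegative and makes [e] positive even if every
   row is tight. *)
pose e := \big[Num.min/x 0 j]_(i | row_sum A x i != b 0 i)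
            (row_sum A x i - b 0 i).
have e0 : 0 < e.
  apply: lt_bigmin => // i xi.
  by rewrite subr_gt0 lt_neqAle eq_sym xi; case: hx => _; apply.
have : lower_coord x j e = x.
  apply: xmin.
    apply: lower_coord_solution => //; first exact: ltW.
      exact: bigmin_le_id.
    (* A non-tight row has slack at least [e]; a tight one has a vanishing term [j]. *)
    move=> i; have := noti i; rewrite negb_and -leNgt => /orP[xi|]; last by left.
    by right; apply: bigmin_le_cond.
  by move=> k; rewrite mxE; case: eqP => // _; lra.
by move/rowP/(_ j); rewrite mxE eqxx; lra.
Qed.
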